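(* Suppose $f:X\to Y$ is an ls-continuous map between ls-spaces. If $f$ is coarsely light and $Y$ is exact, then $X$ is exact.
   Context: For families $\mathcal{B},\mathcal{U}$ of subsets of a set $X$, $\mathrm{st}(B,\mathcal{U})$ is the union of the elements of $\mathcal{U}$ that intersect $B\subseteq X$, and $\mathrm{st}(\mathcal{B},\mathcal{U})=\{\mathrm{st}(B,\mathcal{U})\mid B\in\mathcal{B}\}$. A large scale structure (ls-structure) on $X$ is a nonempty set $\mathcal{L}$ of families of subsets of $X$ (the uniformly bounded families) such that (1) if $\mathcal{B}_1\in\mathcal{L}$ and each element of $\mathcal{B}_2$ with more than one point is contained in an element of $\mathcal{B}_1$, then $\mathcal{B}_2\in\mathcal{L}$; (2) $\mathcal{B}_1,\mathcal{B}_2\in\mathcal{L}$ implies $\mathrm{st}(\mathcal{B}_1,\mathcal{B}_2)\in\mathcal{L}$. An ls-space is a set with an ls-structure. A map $f:X\to Y$ of ls-spaces is ls-continuous if $f(\mathcal{U})=\{f(U)\mid U\in\mathcal{U}\}$ is uniformly bounded for every uniformly bounded $\mathcal{U}$. For a family $\mathcal{U}$ of subsets of $X$ and $A\subseteq X$, the $\mathcal{U}$-components of $A$ are the equivalence classes of the relation on $A$: $x,x'$ are joined by a finite sequence $x=x_1,\dots,x_k=x'$ in $A$ with each pair $x_i,x_{i+1}$ in a common element of $\mathcal{U}$. For uniformly bounded $\mathcal{U}$ in $X$, $\mathcal{V}$ in $Y$, $c(\mathcal{U},f,\mathcal{V})$ is the family of all $\mathcal{U}$-components of sets $f^{-1}(V)$,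 $V\in\mathcal{V}$. The light structure on $X$ with respect to $f$ is the closure under refinement of the set of all $c(\mathcal{U},f,\mathcal{V})$ (all families each of whose elements with more than one point is contained in an element of one fixed $c(\mathcal{U},f,\mathcal{V})$). The map $f$ is coarsely light if the light structure with respect to $f$ equals the ls-structure of $X$. For a set $S$, $\Delta(S)$ is the set of formal linear combinations $\sum_{s\in S}a_s\cdot s$ with $a_s\in[0,1]$, all but finitely many $a_s$ zero, and $\sum_s a_s=1$, with the $l^1$ metric. The star of a vertex $s\in S$ is the set of elements of $\Delta(S)$ with $a_s\neq 0$. A partition of unity on a set $X$ is a map $\phi:X\to\Delta(S)$ for some set $S$. The mesh of a family of subsets of a metric space is the supremum of the diameters of its elements. An ls-space $X$ is exact if for each uniformly bounded cover $\mathcal{U}$ of $X$ and each $\epsilon>0$ there is a partition of unity $\phi:X\to\Delta(S)$ such that the inverse images under $\phi$ of the stars of vertices form a uniformly bounded cover of $X$ and the mesh of $\phi(\mathcal{U})=\{\phi(U)\mid U\in\mathcal{U}\}$ is smaller than $\epsilon$. *)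

(* Defs.v *)
From HB Require Import structures.
From mathcomp Require Import all_boot all_order all_algebra.
From mathcomp Require Import all_classical all_reals all_analysis.

Set Implicit Arguments.
Unset Strict Implicit.
Unset Printing Implicit Defensive.

Import Order.TTheory GRing.Theory Num.Theory.
Local Open Scope classical_set_scope.
Local Open Scope ring_scope.

Definition st (X : Type) (B : set X) (U : set (set X)) : set X :=
  \bigcup_(A in [set A | U A /\ A `&` B !=set0]) A.

Definition st_family (X : Type) (B U : set (set X)) : set (set X) :=
  [set st A U | A in B].

Definition image_family (X Y : Type) (f : X -> Y) (U : set (set X)) :
    set (set Y) :=
  [set f @` A | A in U].

(* [~ is_subset1 A] says that [A] has more than one point. *)
Definition refines (X : Type) (B2 B1 : set (set X)) : Prop :=
  forall A, B2 A -> ~ is_subset1 A -> exists2 A', B1 A' & A `<=` A'.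

Record lsType : Type := LSType {
  ls_sort :> Type;
  ubounded : set (set (set ls_sort));
  ubounded_nonempty : ubounded !=set0;
  ubounded_refines : forall B1 B2,
    ubounded B1 -> refines B2 B1 -> ubounded B2;
  ubounded_st : forall B1 B2,
    ubounded B1 -> ubounded B2 -> ubounded (st_family B1 B2)
}.

Definition ls_continuous (X Y : lsType) (f : X -> Y) : Prop :=
  forall U : set (set X), ubounded U -> ubounded (image_family f U).

(* The sequence is [p 0, ..., p k], so [k = 0] is the one-term sequence. *)
Definition chained (X : Type) (U : set (set X)) (A : set X) (x x' : X) : Prop :=
  exists (k : nat) (p : nat -> X),
    [/\ p 0%N = x, p k = x', (forall i, (i <= k)%N -> A (p i)) &
        forall i, (i < k)%N -> exists2 B, U B & B (p i) /\ B (p i.+1)].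

Definition components (X : Type) (U : set (set X)) (A : set X) : set (set X) :=
  [set [set x' | chained U A x x'] | x in A].

Definition c_family (X Y : Type) (U : set (set X)) (f : X -> Y)
    (V : set (set Y)) : set (set X) :=
  \bigcup_(B in V) components U (f @^-1` B).

Definition light_structure (X Y : lsType) (f : X -> Y) :
    set (set (set X)) :=
  [set W | exists (U : set (set X)) (V : set (set Y)),
     [/\ ubounded U, ubounded V & refines W (c_family U f V)]].

Definition coarsely_light (X Y : lsType) (f : X -> Y) : Prop :=
  light_structure f = @ubounded X.

(* The sum has finite support, hence is the usual finite sum. *)
Record simplex (R : realType) (S : choiceType) : Type := Simplex {
  coef :> S -> R;
  coef_itv : forall s, 0 <= coef s <= 1;
  coef_finite : finite_set [set s | coef s != 0];
  coef_sum : \sum_(s \in [set: S]) coef s = 1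
}.

Definition l1dist (R : realType) (S : choiceType) (a b : simplex R S) : R :=
  \sum_(s \in [set: S]) `|a s - b s|.

Section SimplexMetric.
Context {R : realType} {S : choiceType}.
Implicit Types a b c : simplex R S.

HB.instance Definition _ := gen_eqMixin (simplex R S).
HB.instance Definition _ := gen_choiceMixin (simplex R S).

Lemma simplex_ext a b : (forall s, a s = b s) -> a = b.
Proof.
case: a b => [a a1 a2 a3] [b b1 b2 b3] /= /funext ab; subst b.
by congr Simplex; exact: Prop_irrelevance.
Qed.

Let supp a b : set S := [set s | a s != 0] `|` [set s | b s != 0].

Let l1distE (D : set S) a b : finite_set D -> supp a b `<=` D ->
  l1dist a b = \sum_(s \in D) `|a s - b s|.
Proof.
move=> finD sD; rewrite /l1dist; apply/esym/fsbig_widen => // s [_ Ds] /=.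
have [a0|/eqP a0] := pselect (a s = 0); last by case: Ds; apply: sD; left.
have [b0|/eqP b0] := pselect (b s = 0); last by case: Ds; apply: sD; right.
by rewrite a0 b0 subrr normr0.
Qed.

Let supp_finite a b : finite_set (supp a b).
Proof. by rewrite finite_setU; split; exact: coef_finite. Qed.

Lemma l1distxx a : l1dist a a = 0.
Proof. by rewrite /l1dist; apply: fsbig1 => s _; rewrite subrr normr0. Qed.

Lemma l1dist_positivity a b : l1dist a b = 0 -> a = b.
Proof.
have fab := supp_finite a b.
rewrite (l1distE fab)// fsbig_finite//= => /eqP.
rewrite psumr_eq0// => /allP ab0.
apply: simplex_ext => s; have [sD|sD] := pselect (supp a b s).
  have := ab0 s; rewrite in_fset_set// => /(_ (mem_set sD)).
  by rewrite /= normr_eq0 subr_eq0 => /eqP.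
have [->|/eqP a0] := pselect (a s = 0); last by case: sD; left.
by have [->//|/eqP b0] := pselect (b s = 0); case: sD; right.
Qed.

Lemma l1dist_sym a b : l1dist a b = l1dist b a.
Proof. by apply: eq_fsbigr => s _; rewrite distrC. Qed.

Lemma l1dist_triangle b a c : l1dist a c <= l1dist a b + l1dist b c.
Proof.
have fD : finite_set (supp a b `|` supp b c).
  by rewrite finite_setU; split; exact: supp_finite.
have Dac : supp a c `<=` supp a b `|` supp b c.
  by move=> s [as0|cs0]; [left; left|right; right].
rewrite (l1distE fD Dac) (l1distE fD (@subsetUl _ _ _)).
rewrite (l1distE fD (@subsetUr _ _ _)) !fsbig_finite//= -big_split/=.
by apply: ler_sum => s _; exact: ler_distD.
Qed.

HB.instance Definition _ := isMetric.Build R (simplex R S)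
  l1distxx l1dist_positivity l1dist_sym l1dist_triangle.

Lemma mdist_simplexE a b : mdist a b = l1dist a b.
Proof. by []. Qed.

End SimplexMetric.

Definition star (R : realType) (S : choiceType) (s : S) : set (simplex R S) :=
  [set a | a s != 0].

(* Suprema are taken in [0, +oo], whence the added 0: the diameter of the empty
   set and the mesh of the empty family are 0 rather than -oo. *)
Definition diam (R : realType) (T : metricType R) (A : set T) : \bar R :=
  ereal_sup (0%E |` [set e | exists x y, [/\ A x, A y & e = (mdist x y)%:E]]).

Definition mesh (R : realType) (T : metricType R) (U : set (set T)) : \bar R :=
  ereal_sup (0%E |` [set diam A | A in U]).

Definition ubounded_cover (X : lsType) (U : set (set X)) : Prop :=
  ubounded U /\ cover U id = [set: X].

Definition exact_space (R : realType) (X : lsType) : Prop :=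
  forall (U : set (set X)) (e : R), ubounded_cover U -> 0 < e ->
    exists (S : choiceType) (phi : X -> simplex R S),
      ubounded_cover [set phi @^-1` (star s) | s in [set: S]] /\
      (mesh (image_family phi U) < e%:E)%E.

(* Main.v *)
(** Given a uniformly bounded cover [U] of [X], let [psi] be a partition of
    unity on [Y] with small variation on [f(U)]. Pull it back along [f],
    splitting the vertex [s] into one vertex [(s, C)] for each [U]-component
    [C] of [f^-1(psi^-1(star s))]. The nonempty preimages of the new stars are
    exactly these components, so they are uniformly bounded because [f] is
    coarsely light. Two points of an element of [U] that both lie in
    [f^-1(psi^-1(star s))] lie in the same component, so the splitting does not
    change their [l1] distance. *)
Require Import Defs.
From mathcomp Require Import all_boot all_order all_algebra.
From mathcomp Require Import all_classical all_reals all_analysis.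

Set Implicit Arguments.
Unset Strict Implicit.
Unset Printing Implicit Defensive.

Import Order.TTheory GRing.Theory Num.Theory.
Local Open Scope classical_set_scope.
Local Open Scope ring_scope.

(** Only the graph of [h] contributes, and [s |-> (s, h s)] is a bijection from [S] onto it. *)
Lemma fsbig_graph (R : nmodType) (S C : choiceType) (h : S -> C)
    (F : S * C -> R) : (forall t, t.2 <> h t.1 -> F t = 0) ->
  \sum_(t \in [set: S * C]) F t = \sum_(s \in [set: S]) F (s, h s).
Proof.
move=> F0; rewrite -(@fsbig_widen _ _ _ _ (range (fun s => (s, h s))))//.
  apply: reindex_fsbig; split.
  - by move=> s _; exists s.
  - by move=> s s' _ _ [].
  - by [].
move=> [s c] [_ nsc]; apply: F0 => /= cE; apply: nsc.
by exists s => //; rewrite cE.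
Qed.

Section LiftSimplex.
Context (R : realType) (S C : choiceType).
Implicit Types (a b : simplex R S) (h k : S -> C).

(** Push-forward of [a] along [s |-> (s, h s)]: the whole weight of [s] moves to one vertex above
    it. *)
Let lift_fun a h (t : S * C) : R := if t.2 == h t.1 then a t.1 else 0.

Let lift_itv a h t : 0 <= lift_fun a h t <= 1.
Proof. by rewrite /lift_fun; case: ifP; rewrite ?coef_itv ?lexx ?ler01. Qed.

Let lift_finite a h : finite_set [set t | lift_fun a h t != 0].
Proof.
apply: (@sub_finite_set _ _ ((fun s => (s, h s)) @` [set s | a s != 0])).
  move=> [s c]; rewrite /lift_fun /=.
  by case: (c =P h s) => [->|_]; [exists s | rewrite eqxx].
exact/finite_image/coef_finite.
Qed.

Let lift_sum a h : \sum_(t \in [set: S * C]) lift_fun a h t = 1.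
Proof.
rewrite (@fsbig_graph _ _ _ h) => [|t /eqP/negPf th]; last first.
  by rewrite /lift_fun th.
rewrite -(Defs.coef_sum a); apply: eq_fsbigr => s _.
by rewrite /lift_fun eqxx.
Qed.

Definition lift_simplex a h : simplex R (S * C)%type :=
  Simplex (lift_itv a h) (lift_finite a h) (lift_sum a h).

Lemma lift_simplexE a h t :
  lift_simplex a h t = if t.2 == h t.1 then a t.1 else 0.
Proof. by []. Qed.

Lemma l1dist_lift_simplex a b h k :
  (forall s, a s != 0 -> b s != 0 -> h s = k s) ->
  l1dist (lift_simplex a h) (lift_simplex b k) = l1dist a b.
Proof.
(* As [h] and [k] agree on the common support, both lifts live on the graph of the single function
   [g], so the distance is a sum over that graph. *)
move=> hk; pose g s := if a s != 0 then h s else k s.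
have ag s c : lift_simplex a h (s, c) = if c == g s then a s else 0.
  rewrite lift_simplexE /g /=.
  by case: (eqVneq (a s) 0) => // ->; rewrite !if_same.
have bg s c : lift_simplex b k (s, c) = if c == g s then b s else 0.
  rewrite lift_simplexE /g /=; case: (eqVneq (b s) 0) => [->|b0].
    by rewrite !if_same.
  by case: (boolP (a s != 0)) => // a0; rewrite hk.
rewrite /l1dist (@fsbig_graph _ _ _ g) => [|[s c] /eqP/negPf cg].
  by apply: eq_fsbigr => s _; rewrite ag bg eqxx.
by rewrite ag bg [c == _]cg subrr normr0.
Qed.

End LiftSimplex.

Section Chained.
Context (X : Type) (U : set (set X)) (A : set X).

Lemma chained_refl x : A x -> chained U A x x.
Proof. by move=> Ax; exists 0%N, (fun=> x). Qed.

Lemma chained_step x x' y B : U B -> B x -> B x' -> A x ->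
  chained U A x' y -> chained U A x y.
Proof.
move=> UB Bx Bx' Ax [k [p [p0 pk pA pU]]].
exists k.+1, (fun i => if i is j.+1 then p j else x); split => //.
- by case=> [|i] //; exact: pA.
- by case=> [_|i]; [exists B; rewrite ?p0 | exact: pU].
Qed.

(** A chain starting at either point becomes a chain starting at the other by prepending one link
    inside [B]. *)
Lemma chained_eq x x' B : U B -> B x -> B x' -> A x -> A x' ->
  chained U A x = chained U A x'.
Proof.
by move=> UB Bx Bx' Ax Ax'; apply/seteqP; split=> y;
  [exact: (chained_step UB Bx') | exact: (chained_step UB Bx)].
Qed.

End Chained.

Lemma mesh_le (R : realType) (X : Type) (T T' : metricType R)
    (phi : X -> T) (psi : X -> T') (U : set (set X)) :
  (forall B x x', U B -> B x -> B x' ->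
    mdist (phi x) (phi x') <= mdist (psi x) (psi x')) ->
  (mesh (image_family phi U) <= mesh (image_family psi U))%E.
Proof.
move=> le_dist; apply: ge_ereal_sup => _ [->|[_ [B UB <-] <-]].
  by apply: ereal_sup_ubound; left.
apply: (@le_trans _ _ (diam (psi @` B))); last first.
  by apply: ereal_sup_ubound; right; exists (psi @` B) => //; exists B.
apply: ge_ereal_sup => _ [->|[_ [_ [[x Bx <-] [x' Bx' <-] ->]]]].
  by apply: ereal_sup_ubound; left.
apply: (@le_trans _ _ (mdist (psi x) (psi x'))%:E).
  by rewrite lee_fin; exact: (le_dist B).
apply: ereal_sup_ubound; right; exists (psi x), (psi x').
by split=> //; exact: imageP.
Qed.

Lemma le_mesh (R : realType) (T : metricType R) (U V : set (set T)) :
  U `<=` V -> (mesh U <= mesh V)%E.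
Proof.
move=> UV; apply: ereal_sup_le => _ [->|[A UA <-]]; first by left.
by right; exists A => //; exact: UV.
Qed.

(** Exactness speaks of covers, but [f(U)] need not cover [Y]. Adding singletons repairs this, since
    refinement ignores sets with at most one point. *)
Lemma ubounded_cover_setU_set1 (X : lsType) (U : set (set X)) :
  ubounded U -> ubounded_cover (U `|` range set1).
Proof.
move=> bU; split.
  apply: (ubounded_refines bU) => A [UA _|[x _ <-] nx]; first by exists A.
  by case: nx => y z -> ->.
by apply/seteqP; split=> // x _; exists [set x] => //; right; exists x.
Qed.

Theorem theorem9p3 (R : realType) (X Y : lsType) (f : X -> Y) :
  ls_continuous f -> coarsely_light f -> exact_space R Y -> exact_space R X.
Proof.
move=> fcont flight Yexact U e [bU _] e0.
have [S [psi [[bstar _] psie]]] :=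
  Yexact _ e (ubounded_cover_setU_set1 (fcont _ bU)) e0.
pose W s := f @^-1` (psi @^-1` star s).
(* For [x] outside [W s] this set is empty, but then [s] has weight 0 in [psi (f x)]. *)
pose comp x s : set X := chained U (W s) x.
pose phi x := lift_simplex (psi (f x)) (comp x).
have phi_star s c x : star (s, c) (phi x) <-> W s x /\ c = comp x s.
  rewrite /star /mkset lift_simplexE /=; case: (c =P comp x s) => [->|nc].
    by split=> [|[]].
  by rewrite eqxx; split=> // -[].
exists (S * set X)%type, phi; split; last first.
  apply: le_lt_trans psie.
  apply: (@le_trans _ _ (mesh (image_family (psi \o f) U))).
    apply: mesh_le => B x x' UB Bx Bx'.
    rewrite !mdist_simplexE /= l1dist_lift_simplex// => s xs x's.
    exact: (chained_eq UB).
  apply: le_mesh => _ [B UB <-].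
  by exists (f @` B); [left; exists B | rewrite image_comp].
split.
  rewrite -flight; exists U, [set psi @^-1` star s | s in [set: S]].
  (* Here [c] is an arbitrary set; a point [x] of the preimage identifies it as the component of
     [x]. *)
  split=> // _ [[s c] _ <-] /existsNP[x /existsNP[z /not_implyP[]]].
  move=> /phi_star[Wx ->] _; exists (comp x s).
    by exists (psi @^-1` star s); [exists s | exists x].
  by move=> y /phi_star[Wy ->]; exact: chained_refl.
apply/seteqP; split=> // x _.
(* The weights sum to 1, so they cannot all vanish. *)
have [s xs] : exists s, psi (f x) s != 0.
  apply/not_existsP => x0; have := Defs.coef_sum (psi (f x)).
  rewrite fsbig1 => [/esym/eqP|s _]; first by rewrite oner_eq0.
  by apply/eqP/negPn/negP; exact: x0.
exists (phi @^-1` star (s, comp x s)); first by exists (s, comp x s).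
exact/phi_star.
Qed.
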